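(* There are exactly nine compatible additions on the labelled multiplicative semigroup $M$, and they fall into exactly six isomorphism types. They are denoted by $R_{ij}$, $i,j\in\{0,1,2\}$, with $R_{ij}\cong R_{ji}$ and no other identifications up to isomorphism. In $R_{ij}$ the additive order is the (reflexive) transitive closure of $$a<p<0,\qquad b<q<0,\qquad c<0,$$ together with the relations stating that the first $i$ elements of the chain $a<p$ lie below $c$ and the first $j$ elements of the chain $b<q$ lie below $c$.
   Context: An ai-semiring is an algebra $(S,+,\cdot)$ with two binary operations such that $+$ is associative, commutative and idempotent, $\cdot$ is associative, and both distributive laws hold. Its additive order is $x\le y$ iff $x+y=y$ (so $+$ is the join operation). $M=\{0,c,p,q,a,b\}$ (six distinct elements; $0$ is only a name of an element, not a constant of the language) is the commutative semigroup whose only nonzero products are $pb=bp=ab=ba=aq=qa=c$; every other product, including every square, is $0$. A compatible addition on $M$ is a binary operation $+$ on the set $M$ such that $(M,+,\cdot)$ is an ai-semiring with this fixed multiplication. Isomorphism types are isomorphism types of the resulting ai-semirings $(M,+,\cdot)$. ''The first $i$ elements of the chain $a<p$ lie below $c$'' means: nothing is added for $i=0$, $a<c$ for $i=1$, and $a<c,\ p<c$ for $i=2$; similarly for $j$ and the chain $b<q$. *)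

(* Defs.v *)
From HB Require Import structures.
From mathcomp Require Import all_boot boolp.

Set Implicit Arguments.
Unset Strict Implicit.
Unset Printing Implicit Defensive.

Record ai_semiring (S : Type) (add mul : S -> S -> S) : Prop := AiSemiring {
  ai_addA : associative add;
  ai_addC : commutative add;
  ai_addxx : idempotent_op add;
  ai_mulA : associative mul;
  ai_mulDl : left_distributive mul add;
  ai_mulDr : right_distributive mul add
}.

Definition ai_isomorphic (S T : Type) (addS mulS : S -> S -> S)
    (addT mulT : T -> T -> T) : Prop :=
  exists f : S -> T,
    [/\ bijective f, {morph f : x y / addS x y >-> addT x y}
      & {morph f : x y / mulS x y >-> mulT x y}].

Definition add_le (S : eqType) (add : S -> S -> S) : rel S :=
  fun x y => add x y == y.

Inductive M : predArgType := M0 | Mc | Mp | Mq | Ma | Mb.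

Definition M_to_ord (x : M) : 'I_6 :=
  match x with
  | M0 => @Ordinal 6 0 isT
  | Mc => @Ordinal 6 1 isT
  | Mp => @Ordinal 6 2 isT
  | Mq => @Ordinal 6 3 isT
  | Ma => @Ordinal 6 4 isT
  | Mb => @Ordinal 6 5 isT
  end.

Definition ord_to_M (i : 'I_6) : M := nth M0 [:: M0; Mc; Mp; Mq; Ma; Mb] i.

Lemma M_to_ordK : cancel M_to_ord ord_to_M.
Proof. by case. Qed.

HB.instance Definition _ := Countable.copy M (can_type M_to_ordK).
HB.instance Definition _ : isFinite M := CanIsFinite M_to_ordK.

Definition mulM (x y : M) : M :=
  match x, y with
  | Mp, Mb | Mb, Mp | Ma, Mb | Mb, Ma | Ma, Mq | Mq, Ma => Mc
  | _, _ => M0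
  end.

(* Binary operations on M are taken as finite functions so that they form a
   finite type and can be counted. *)
Definition opM := {ffun M * M -> M}.

Definition app_opM (f : opM) (x y : M) : M := f (x, y).

Definition compatible_additions : {set opM} :=
  [set f : opM | `[< ai_semiring (app_opM f) mulM >]].

Definition isoM (f g : opM) : Prop :=
  ai_isomorphic (app_opM f) mulM (app_opM g) mulM.

Definition isomorphism_types : {set {set opM}} :=
  equivalence_partition (fun f g => `[< isoM f g >]) compatible_additions.

Definition gen_lt (i j : nat) : rel M := fun x y =>
  [|| (x, y) \in [:: (Ma, Mp); (Mp, M0); (Mb, Mq); (Mq, M0); (Mc, M0)],
      (x \in take i [:: Ma; Mp]) && (y == Mc)
    | (x \in take j [:: Mb; Mq]) && (y == Mc)].

(* Main.v *)
(* Distributivity makes every multiplication map x |-> x u a join morphism into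
   {0, c}.  If 0 < c, the preimages {a} and {b} of c under multiplication by q
   and p would both be the top element; hence c < 0, and the product profile of
   x + y is c exactly where those of x and y both are.  Profiles separate all
   elements except 0 and c, which yields a + p = p, b + q = q, 0 on top, and
   x + y in {0, c} otherwise, with x + y = c iff x and y both lie below c.  So the
   addition is determined by the two down-sets of the chains a < p and b < q
   consisting of the elements below c.  The only automorphisms of the
   multiplicative semigroup are the identity and the exchange of (a, p) with
   (b, q). *)
Require Import Defs.
From mathcomp Require Import all_boot boolp.

Set Implicit Arguments.
Unset Strict Implicit.
Unset Printing Implicit Defensive.

Definition below_c (i j : nat) (x : M) : bool :=
  match x with
  | M0 => false
  | Mc => true
  | Ma => 0 < i
  | Mp => 1 < i
  | Mb => 0 < j
  | Mq => 1 < j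
  end.

Definition addR (i j : nat) (x y : M) : M :=
  match x, y with
  | Ma, Ma => Ma
  | Ma, Mp | Mp, Ma | Mp, Mp => Mp
  | Mb, Mb => Mb
  | Mb, Mq | Mq, Mb | Mq, Mq => Mq
  | _, _ => if below_c i j x && below_c i j y then Mc else M0
  end.

Definition opR (i j : nat) : opM := [ffun xy => addR i j xy.1 xy.2].

Definition swapM (x : M) : M :=
  match x with
  | M0 => M0 | Mc => Mc | Ma => Mb | Mb => Ma | Mp => Mq | Mq => Mp
  end.

Lemma app_opR i j : app_opM (opR i j) = addR i j.
Proof. by apply/funext => x; apply/funext => y; rewrite /app_opM ffunE. Qed.

Lemma addR_ai_semiring i j : ai_semiring (addR i j) mulM.
Proof.
by case: i => [|[|i]]; case: j => [|[|j]]; split;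
  do 3?[case=> //]; do 2?[case=> //].
Qed.

(** This recovers the table [below_c] from the addition alone, so an isomorphism fixing [Mc]
    transports it. *)
Lemma addR_c i j x : (addR i j x Mc == Mc) = below_c i j x.
Proof. by case: x i j => [] [|[|i]] [|[|j]]. Qed.

Lemma addR_inj (i j k l : 'I_3) :
  below_c i j =1 below_c k l -> (i, j) = (k, l).
Proof.
move=> e; have := (e Ma, e Mp, e Mb, e Mq) => -[[[]]] /=.
case: i j k l {e} => [[|[|[|//]]] ?] [[|[|[|//]]] ?] [[|[|[|//]]] ?]
  [[|[|[|//]]] ?] //= _ _ _ _; congr pair; exact: val_inj.
Qed.

Section CompatibleAddition.

Variable add : M -> M -> M.
Hypothesis S : ai_semiring add mulM.

Let addA := ai_addA S.
Let addC := ai_addC S.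
Let addxx := ai_addxx S.
Let mulDl := ai_mulDl S.
Let mulDr := ai_mulDr S.

(** As [c + 0 = b(p + 0)] is a product, it is [0] or [c]. In the latter case both [(a + b)p] and
    [(a + b)q] equal [c], but [zp = c] forces [z = b] and [zq = c] forces [z = a]. *)
Lemma add_c0 : add Mc M0 = M0.
Proof.
have := mulDr Mb Mp M0; rewrite /=; case e: (add Mc M0) => //; case: (add Mp M0) => //= _;
  have /= := mulDl Ma Mb Mp; have /= := mulDl Ma Mb Mq;
  by rewrite (addC M0) e; case: (add Ma Mb).
Qed.

Lemma mulM_add x y u :
  mulM (add x y) u = if (mulM x u == Mc) && (mulM y u == Mc) then Mc else M0.
Proof.
have V z : mulM z u = M0 \/ mulM z u = Mc by case: z u => [] []; auto.
rewrite mulDl; case: (V x) => ->; case: (V y) => -> /=.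
- exact: addxx.
- by rewrite addC add_c0.
- exact: add_c0.
- exact: addxx.
Qed.

Lemma mulM_profile z z' : mulM z =1 mulM z' ->
  z = z' \/ z \in [:: M0; Mc].
Proof.
move=> e; have := (e Ma, e Mb, e Mp, e Mq) => -[[[]]].
by case: z z' {e} => [] [] //=; auto.
Qed.

(** Here [addR 0 0] is a reference addition: its sums have the product profiles that [mulM_add]
    forces on those of [add]. *)
Lemma add_profile x y : add x y = addR 0 0 x y \/ add x y \in [:: M0; Mc].
Proof. by apply: mulM_profile => u; rewrite mulM_add; case: x y u => [] [] []. Qed.

Lemma add_c_or_0 x y : addR 0 0 x y \in [:: M0; Mc] ->
  add x y = if (add x Mc == Mc) && (add y Mc == Mc) then Mc else M0.
Proof.
move=> xy; have: add x y \in [:: M0; Mc] by case: (add_profile x y) => // ->.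
rewrite !inE => /orP[] /eqP e; rewrite e.
  (* If [x + y = 0] with [x] and [y] below [c], then [0 = c + 0 = c + (x + y) = c]. *)
  case: ifP => // /andP[/eqP xc /eqP yc].
  by rewrite -[M0]add_c0 -e addC -addA yc xc.
by rewrite -e addA addxx (addC x y) addA addxx eqxx.
Qed.

Lemma add_not_c_or_0 x y : addR 0 0 x y \notin [:: M0; Mc] ->
  add x y = addR 0 0 x y.
Proof.
move=> xy; have: mulM (add x y) =1 mulM (addR 0 0 x y).
  by move=> u; rewrite mulM_add; case: x y u {xy} => [] [] [].
by move=> e; case: (mulM_profile (fsym e)) => // xy'; rewrite xy' in xy.
Qed.

Lemma compatible_addR : exists i j : 'I_3, add = addR i j.
Proof.
pose b x := add x Mc == Mc.
have b_mono x y : add x y = y -> b y -> b x.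
  by move=> xy /eqP yc; rewrite /b -{2}yc -xy -{1}yc addA xy yc.
have bap : b Mp -> b Ma by apply: b_mono; apply: add_not_c_or_0.
have bbq : b Mq -> b Mb by apply: b_mono; apply: add_not_c_or_0.
have lt3 (u v : bool) : u + v < 3 by case: u v => [] [].
(* The indices count the elements of each chain below [c]. By [bap] and [bbq] these elements form an
   initial segment, so the count determines them. *)
exists (Ordinal (lt3 (b Ma) (b Mp))), (Ordinal (lt3 (b Mb) (b Mq))).
set i := Ordinal _; set j := Ordinal _.
have bE x : b x = below_c i j x.
  case: x => /=; first by rewrite /b addC add_c0.
  - by rewrite /b addxx.
  - by case: (b Mp) bap => [->|_] //; case: (b Ma).
  - by case: (b Mq) bbq => [->|_] //; case: (b Mb).
  - by case: (b Ma) bap; case: (b Mp) => // /(_ isT).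
  - by case: (b Mb) bbq; case: (b Mq) => // /(_ isT).
apply/funext => x; apply/funext => y.
have [xy|xy] := boolP (addR 0 0 x y \in [:: M0; Mc]).
  rewrite (add_c_or_0 xy) -/(b x) -/(b y) !bE.
  by case: x y xy => [] [].
by rewrite (add_not_c_or_0 xy); case: x y xy => [] [].
Qed.

End CompatibleAddition.

Lemma compatible_additionsE :
  compatible_additions = [set opR i j | i : 'I_3, j : 'I_3].
Proof.
apply/setP => f; rewrite inE; apply/asboolP/imset2P => [/compatible_addR[i [j e]]|].
  exists i j => //; apply/ffunP => -[x y].
  by rewrite ffunE -[f _]/(app_opM f x y) e.
by case=> i j _ _ ->; rewrite app_opR; apply: addR_ai_semiring.
Qed.

Lemma mulM_automorphism f : injective f -> {morph f : x y / mulM x y} ->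
  f =1 id \/ f =1 swapM.
Proof.
move=> finj fM.
have f0 : f M0 = M0 by rewrite -[M0 in LHS]/(mulM M0 M0) fM; case: (f M0).
have fc : f Mc = Mc.
  have: f Mc != M0 by rewrite -f0 inj_eq.
  by rewrite -[Mc]/(mulM Ma Mb) fM; case: (f Ma) (f Mb) => [] [].
(* The nonzero products form the path [p - b - a - q]. A walk of three edges on it with nonadjacent
   ends is the path itself or its reversal. *)
have := (fM Ma Mb, fM Ma Mq, fM Mp Mb, fM Mp Mq); rewrite /= f0 fc => -[[[]]].
case ea: (f Ma); case eb: (f Mb) => //; case eq: (f Mq) => //;
  case ep: (f Mp) => // _ _ _ _; [left|right]; by case.
Qed.

(** An isomorphism fixes [c], hence preserves being below [c]; that property determines the indices
    once the automorphism is known. *)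
Lemma isoM_opR (i j k l : 'I_3) :
  isoM (opR i j) (opR k l) <-> (i, j) = (k, l) \/ (i, j) = (l, k).
Proof.
rewrite /isoM !app_opR; split=> [[f [/bij_inj finj fD fM]]|].
  have bE x : f Mc = Mc -> below_c i j x = below_c k l (f x).
    by move=> fc; rewrite -!addR_c -(inj_eq finj) fD fc.
  case: (mulM_automorphism finj fM) => fE; [left|right]; apply: addR_inj => x;
    by rewrite bE fE //; case: x.
case=> -[-> ->]; first by exists id; split=> //; exists id.
exists swapM; split; last by do 2!case.
  by exists swapM; case.
by do 2!case=> //=; case: ifP.
Qed.

Lemma add_leR i j : add_le (addR i j) =2 connect (gen_lt i j).
Proof.
move=> x y; apply/idP/idP => [|/connectP[s]].
  have two_steps z : gen_lt i j x z -> gen_lt i j z y -> connect (gen_lt i j) x y.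
    by move=> xz zy; apply: connect_trans (connect1 xz) (connect1 zy).
  case: (eqVneq x y) => [->|xy]; first by rewrite connect0.
  have [xy1 _|xy1 le_xy] := boolP (gen_lt i j x y); first exact: connect1.
  (* The only strict relations that are not generators are [a < 0], through [p], and [b < 0],
     through [q]. *)
  have : gen_lt i j x Mp && gen_lt i j Mp y || gen_lt i j x Mq && gen_lt i j Mq y.
    by move: xy xy1 le_xy; case: x y {two_steps} => [] []; case: i => [|[|i]];
       case: j => [|[|j]].
  by case/orP=> /andP[]; apply: two_steps.
have [addA addC addxx _ _ _] := addR_ai_semiring i j.
elim: s x => [|z s IHs] x /=; first by move=> _ ->; rewrite /add_le addxx.
case/andP=> xz zs ys; move/eqP: (IHs z zs ys) => zy.
have /eqP xz' : add_le (addR i j) x z.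
  by move: xz; case: x z {zs ys zy} => [] []; case: i {addA addC addxx IHs} => [|[|i]];
     case: j => [|[|j]].
by rewrite /add_le -{1}zy addA xz' zy.
Qed.

Lemma opR_inj : injective (fun ij : 'I_3 * 'I_3 => opR ij.1 ij.2).
Proof.
move=> [i j] [k l] /= e; apply: addR_inj => x.
by rewrite -!addR_c -!app_opR e.
Qed.

Lemma card_compatible_additions : #|compatible_additions| = 9.
Proof.
have -> : compatible_additions = [set opR ij.1 ij.2 | ij : 'I_3 * 'I_3].
  rewrite compatible_additionsE; apply/setP => f.
  apply/imset2P/imsetP => [[i j _ _ ->]|[[i j] _ ->]]; first by exists (i, j).
  by exists i j.
by rewrite (card_imset _ opR_inj) card_prod card_ord.
Qed.

Lemma card_isomorphism_types : #|isomorphism_types| = 6.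
Proof.
pose cls f := [set g in compatible_additions | `[< isoM f g >]].
(* Pairs with [i <= j] represent each class exactly once; there are [3 + 2 + 1] of them. *)
pose T := [set ij : 'I_3 * 'I_3 | ij.1 <= ij.2].
have RC (i j : 'I_3) : opR i j \in compatible_additions.
  by rewrite compatible_additionsE imset2_f.
have clsE (i j k l : 'I_3) :
    (opR i j \in cls (opR k l)) = ((i, j) \in [:: (k, l); (l, k)]).
  rewrite inE RC !inE /=; apply/asboolP/orP; rewrite isoM_opR.
    by case=> -[-> ->]; rewrite !eqxx; auto.
  by case=> /eqP[-> ->]; auto.
have -> : isomorphism_types = [set cls (opR ij.1 ij.2) | ij : 'I_3 * 'I_3 in T].
  apply/setP => C; apply/imsetP/imsetP => [[f]|[[i j] _ ->]]; last first.
    by exists (opR i j).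
  rewrite {1}compatible_additionsE => /imset2P[i j _ _ ->] ->; rewrite -/(cls _).
  have [le_ij|/ltnW le_ji] := leqP i j; first by exists (i, j); rewrite ?inE.
  exists (j, i); rewrite ?inE //; apply/setP => g.
  have [|gN] := boolP (g \in compatible_additions); last by rewrite in_set [RHS]in_set (negPf gN).
  rewrite compatible_additionsE => /imset2P[k l _ _ ->] /=.
  by rewrite !clsE !inE orbC.
rewrite card_in_imset => [|[i j] [k l]]; rewrite ?inE /=.
  rewrite -sum1_card (eq_bigl (fun ij : 'I_3 * 'I_3 => ij.1 <= ij.2)) => [|ij]; last by rewrite inE.
  rewrite -(pair_big_dep xpredT (fun i j : 'I_3 => i <= j) (fun _ _ => 1)) /=.
  under eq_bigr do rewrite big_mkcond.
  by rewrite !(big_ord_recl, big_ord0).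
move=> le_ij le_kl /setP/(_ (opR i j)); rewrite !clsE !inE eqxx /= => /esym/orP[] /eqP //.
(* Two sorted pairs that are swaps of each other have all entries equal. *)
case=> eil ejk; rewrite eil ejk in le_ij *.
by have -> : k = l by apply/val_inj/anti_leq; rewrite le_ij le_kl.
Qed.

Theorem theorem2p1 :
  [/\ #|compatible_additions| = 9,
      #|isomorphism_types| = 6
    & exists R : 'I_3 -> 'I_3 -> opM,
        [/\ compatible_additions = [set R i j | i : 'I_3, j : 'I_3],
            forall i j k l : 'I_3,
              isoM (R i j) (R k l) <-> (i, j) = (k, l) \/ (i, j) = (l, k)
          & forall i j : 'I_3,
              add_le (app_opM (R i j)) =2 connect (gen_lt i j)]].
Proof.
split; [exact: card_compatible_additions | exact: card_isomorphism_types |].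
exists (fun i j => opR i j); split.
- exact: compatible_additionsE.
- exact: isoM_opR.
- by move=> i j; rewrite app_opR; apply: add_leR.
Qed.
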